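(* Consider a convex optimal path parameterization problem (COPP, as defined in the context) satisfying the compactness, Lipschitz, and admissible-control regularity assumptions of the context. For a loop index $p\ge 0$, let $\mathcal V_k^p$ ($0\le k\le N$) be the cut-based approximate value functions constructed in the backward pass of the RDDP process (see context), and let $\mathbf x_0^{p*}=(\boldsymbol x_k^{p*})_{k=0}^N$, $\mathbf u_0^{p*}=(u_k^{p*})_{k=0}^{N-1}$ be the (feasible) trial trajectory generated in the forward pass. Let $J^*$ be the globally optimal value of the COPP. Then $$0\le J_0(\mathbf x_0^{p*},\mathbf u_0^{p*})-J^*\le \varepsilon_{\mathrm{gap}}(\mathbf x_0^{p*},\mathbf u_0^{p*}),\qquad \varepsilon_{\mathrm{gap}}(\mathbf x_0^{p*},\mathbf u_0^{p*}):=J_0(\mathbf x_0^{p*},\mathbf u_0^{p*})-\mathcal V_0^p(\boldsymbol x_0^{p*}),$$ where $J_0(\mathbf x_0,\mathbf u_0)=\sum_{k=0}^{N-1}L_k(\boldsymbol x_k,u_k)+\Phi(\boldsymbol x_N)$.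
   Context: **Problem.** Fix integers $m\ge2$, $N\ge1$ and $\Delta_k>0$ for $0\le k\le N-1$. Let $\boldsymbol A_k\in\mathbb R^{(m-1)\times(m-1)}$ have entries $(\boldsymbol A_k)_{ij}=\Delta_k^{j-i}/(j-i)!$ for $j\ge i$ and $0$ otherwise, and let $\boldsymbol b_k\in\mathbb R^{m-1}$ have entries $(\boldsymbol b_k)_i=\Delta_k^{m-i}/(m-i)!$. The problem is to minimize $\sum_{k=0}^{N-1}L_k(\boldsymbol x_k,u_k)+\Phi(\boldsymbol x_N)$ over $\boldsymbol x_k\in\mathbb R^{m-1}$ ($0\le k\le N$), $u_k\in\mathbb R$ ($0\le k\le N-1$), subject to $\boldsymbol x_{k+1}=\boldsymbol A_k\boldsymbol x_k+\boldsymbol b_ku_k$, $\boldsymbol f_k(\boldsymbol x_k)\le\boldsymbol 0$, $\boldsymbol h_k(\boldsymbol x_k,u_k)\le\boldsymbol 0$ for $0\le k\le N-1$ (componentwise), $\boldsymbol x_0\in\mathcal X_0$, $\boldsymbol x_N\in\mathcal X_{\mathrm f}$. **Assumption (regularity).** $L_k,\Phi$ (real-valued) and $\boldsymbol f_k,\boldsymbol h_k$ (vector-valued) are locally Lipschitz; $\mathcal X_0$, $\mathcal X_{\mathrm f}$ and each set $\{(\boldsymbol x,u)\mid\boldsymbol f_k(\boldsymbol x)\le\boldsymbol 0,\ \boldsymbol h_k(\boldsymbol x,u)\le\boldsymbol 0\}$ are compact. **COPP.** In addition, $L_k,\Phi$ and all components of $\boldsymbol f_k,\boldsymbol h_k$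 are convex, $\mathcal X_0,\mathcal X_{\mathrm f}$ are convex, and the problem is feasible. **Reachable and control sets.** $\mathcal B_N=\mathcal X_{\mathrm f}$ and, for $k<N$, $\mathcal B_k$ is the set of $\boldsymbol x_k$ for which there exist $\boldsymbol x_{k+1},\dots,\boldsymbol x_N,u_k,\dots,u_{N-1}$ with $\boldsymbol x_{j+1}=\boldsymbol A_j\boldsymbol x_j+\boldsymbol b_ju_j$, $\boldsymbol f_j(\boldsymbol x_j)\le\boldsymbol0$, $\boldsymbol h_j(\boldsymbol x_j,u_j)\le\boldsymbol0$ for all $k\le j<N$, and $\boldsymbol x_N\in\mathcal X_{\mathrm f}$. For $\boldsymbol x_k\in\mathcal B_k$, $k<N$, $\mathcal C_k(\boldsymbol x_k)=\{u\in\mathbb R\mid\boldsymbol h_k(\boldsymbol x_k,u)\le\boldsymbol0,\ \boldsymbol A_k\boldsymbol x_k+\boldsymbol b_ku\in\mathcal B_{k+1}\}$. **Assumption (admissible controls).** For each $k<N$ and $\boldsymbol x\in\mathcal B_k$, $\mathcal C_k(\boldsymbol x)=[\underline u_k(\boldsymbol x),\bar u_k(\boldsymbol x)]$, where $\underline u_k$ and $-\bar u_k$ are convex and both $\underline u_k,\bar u_k$ are locally Lipschitz on $\mathcal B_k$. **RDDP process.** For each loop $p=0,1,2,\dots$ and each $k<N$ there is a nonempty finite set of sample points $\mathcal S_k^p\subset\mathcal B_k$, where $\mathcal S_k^0$ is arbitrary. *Backward pass:* $\mathcal V_N^p=\Phi$ on $\mathcal B_N$, and for $k=N-1,\dots,0$,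 for $\boldsymbol x\in\mathcal B_k$, $$\widehat{\mathcal V}_k^p(\boldsymbol x)=\min_{u\in\mathcal C_k(\boldsymbol x)}L_k(\boldsymbol x,u)+\mathcal V_{k+1}^p(\boldsymbol A_k\boldsymbol x+\boldsymbol b_ku),\qquad \mathcal V_k^p(\boldsymbol x)=\max_{\boldsymbol y\in\mathcal S_k^p}\big\{\widehat{\mathcal V}_k^p(\boldsymbol y)+\boldsymbol g(\boldsymbol y)^\top(\boldsymbol x-\boldsymbol y)\big\},$$ where $\boldsymbol g(\boldsymbol y)\in\partial^\circ\widehat{\mathcal V}_k^p(\boldsymbol y)$ is any chosen Clarke subgradient. Here, for a locally Lipschitz function $f$ on a convex set $\mathcal B$, $\partial^\circ f(\boldsymbol y)$ is the convex hull of all limits of gradients $\nabla f(\boldsymbol y_n)$ with $\boldsymbol y_n\to\boldsymbol y$, $\boldsymbol y_n$ in the relative interior of $\mathcal B$ and $f$ differentiable at $\boldsymbol y_n$ relative to the affine hull of $\mathcal B$ (gradients taken in the direction space of the affine hull). *Forward pass:* $\boldsymbol x_0^{p*}\in\arg\min_{\boldsymbol x\in\mathcal B_0\cap\mathcal X_0}\mathcal V_0^p(\boldsymbol x)$ and, for $k=0,\dots,N-1$, $u_k^{p*}\in\arg\min_{u\in\mathcal C_k(\boldsymbol x_k^{p*})}L_k(\boldsymbol x_k^{p*},u)+\mathcal V_{k+1}^p(\boldsymbol A_k\boldsymbol x_k^{p*}+\boldsymbol b_ku)$, $\boldsymbol x_{k+1}^{p*}=\boldsymbol A_k\boldsymbol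 x_k^{p*}+\boldsymbol b_ku_k^{p*}$. *Update:* $\mathcal S_k^{p+1}$ is any finite subset of $\mathcal B_k$ with $\mathcal S_k^{p+1}\supset\mathcal S_k^p\cup\{\boldsymbol x_k^{p*}\}$. *)

(* Defs.v *)
From HB Require Import structures.
From mathcomp Require Import all_boot all_order all_algebra.
From mathcomp Require Import all_classical all_reals all_analysis.

Set Implicit Arguments.
Unset Strict Implicit.
Unset Printing Implicit Defensive.

Import Order.TTheory GRing.Theory Num.Theory.
Import numFieldNormedType.Exports.

Local Open Scope classical_set_scope.
Local Open Scope ring_scope.

Section Convex_analysis.
Context {R : realType}.

Definition dotv n (v w : 'cV[R]_n) : R := (v^T *m w) 0 0.

Definition affine_hull n (A : set 'cV[R]_n) : set 'cV[R]_n :=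
  [set v | exists (d : nat) (w : 'I_d -> R) (a : 'I_d -> 'cV[R]_n),
    [/\ \sum_i w i = 1, forall i, A (a i) & v = \sum_i w i *: a i]].

Definition convex_hull n (A : set 'cV[R]_n) : set 'cV[R]_n :=
  [set v | exists (d : nat) (w : 'I_d -> R) (a : 'I_d -> 'cV[R]_n),
    [/\ forall i, 0 <= w i, \sum_i w i = 1, forall i, A (a i)
      & v = \sum_i w i *: a i]].

Definition direction_space n (A : set 'cV[R]_n) : set 'cV[R]_n :=
  [set x - y | x in affine_hull A & y in affine_hull A].

Definition relative_interior n (A : set 'cV[R]_n) : set 'cV[R]_n :=
  [set x | A x /\ exists2 U, nbhs x U & affine_hull A `&` U `<=` A].

(* The library's [locally [lipschitz _ | _ in A]] quantifies over all points of
   A `*` A, off the diagonal included; this is the usual pointwise notion, the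
   neighbourhoods being relative to A. *)
Definition locally_lipschitz (V W : normedModType R) (A : set V) (f : V -> W) :=
  forall x, A x -> exists2 U, nbhs x U & [lipschitz f y | y in A `&` U].

(* v is the gradient of f at y relative to the affine hull of B, taken in the
   direction space of that hull: f z - f y - <v, z - y> = o(`|z - y|) as z
   tends to y in the hull.  The matrix norm is the sup norm, which in finite
   dimension gives the same notion as the Euclidean norm. *)
Definition relative_gradient n (B : set 'cV[R]_n) (f : 'cV[R]_n -> R)
    (y v : 'cV[R]_n) :=
  direction_space B v /\
  forall e : R, 0 < e -> \forall z \near within (affine_hull B) (nbhs y),
    `|f z - f y - dotv v (z - y)| <= e * `|z - y|.

(* Only the values of f on B matter: around a point of the relative interior,
   the affine hull of B coincides with B. *)
Definition clarke_subdifferential n (B : set 'cV[R]_n) (f : 'cV[R]_n -> R)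
    (y : 'cV[R]_n) : set 'cV[R]_n :=
  convex_hull [set g | exists (s t : nat -> 'cV[R]_n),
    [/\ forall i, relative_interior B (s i),
        forall i, relative_gradient B f (s i) (t i),
        s @ \oo --> y & t @ \oo --> g]].

Definition argmin T (A : set T) (F : T -> R) : set T :=
  [set x | A x /\ forall y, A y -> F x <= F y].

End Convex_analysis.

Notation state R m := 'cV[R]_(m.-1).

(* Stage data are indexed by all of nat, but only the stages k < N are ever
   used.  [nf k] and [nh k] are the numbers of components of f_k and h_k. *)
Record path_problem (R : realType) (m N : nat) := PathProblem {
  Delta : nat -> R;
  nf : nat -> nat;
  nh : nat -> nat;
  stage_cost : nat -> state R m * R -> R;
  final_cost : state R m -> R;
  state_constr : forall k, state R m -> 'cV[R]_(nf k);
  control_constr : forall k, state R m * R -> 'cV[R]_(nh k);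
  init_set : set (state R m);
  final_set : set (state R m) }.

Section Problem.
Context {R : realType} {m N : nat} (P : path_problem R m N).

Implicit Types (x y : state R m) (u : R) (k p : nat).
Implicit Types (xs : nat -> state R m) (us : nat -> R).

Definition sysA k : 'M[R]_(m.-1) :=
  \matrix_(i, j) if (i <= j)%N then Delta P k ^+ (j - i) / (j - i)`!%:R else 0.

(* Rows are numbered from 0, so the exponent m - i becomes m - i.+1. *)
Definition sysb k : 'cV[R]_(m.-1) :=
  \col_i (Delta P k ^+ (m - i.+1) / (m - i.+1)`!%:R).

Definition next_state k x u : state R m := sysA k *m x + u *: sysb k.

Definition state_ok k x := forall i, state_constr P k x i 0 <= 0.

Definition control_ok k x u := forall i, control_constr P k (x, u) i 0 <= 0.

(* Trajectories are sequences over nat; only x_0, ..., x_N and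
   u_0, ..., u_(N-1) are constrained and enter the cost. *)
Definition follows k xs us := forall j, (k <= j < N)%N ->
  [/\ xs j.+1 = next_state j (xs j) (us j), state_ok j (xs j)
    & control_ok j (xs j) (us j)].

Definition feasible xs us :=
  [/\ follows 0 xs us, init_set P (xs 0%N) & final_set P (xs N)].

Definition total_cost xs us : R :=
  \sum_(k < N) stage_cost P k (xs k, us k) + final_cost P (xs N).

Definition optimal_value : R :=
  inf [set J | exists xs us, feasible xs us /\ J = total_cost xs us].

(* For k = N no stage is constrained, and this is the terminal set. *)
Definition reach k : set (state R m) :=
  [set x | exists xs us,
    [/\ xs k = x, follows k xs us & final_set P (xs N)]].

Definition controls k x : set R :=
  [set u | control_ok k x u /\ reach k.+1 (next_state k x u)].

Definition regular :=
  [/\ forall k, (k < N)%N ->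
        [/\ locally_lipschitz setT (stage_cost P k),
            locally_lipschitz setT (@state_constr _ _ _ P k)
          & locally_lipschitz setT (@control_constr _ _ _ P k)],
      locally_lipschitz setT (final_cost P),
      compact (init_set P),
      compact (final_set P)
    & forall k, (k < N)%N ->
        compact [set z | state_ok k z.1 /\ control_ok k z.1 z.2]].

Definition is_copp :=
  [/\ forall k, (k < N)%N ->
        [/\ convex_function setT (stage_cost P k),
            forall i, convex_function setT (fun x => state_constr P k x i 0)
          & forall i, convex_function setT (fun z => control_constr P k z i 0)],
      convex_function setT (final_cost P),
      convex_set (init_set P),
      convex_set (final_set P)
    & exists xs us, feasible xs us].

Definition admissible_controls :=
  exists lo hi : nat -> state R m -> R, forall k, (k < N)%N ->
    [/\ forall x, reach k x -> controls k x = `[lo k x, hi k x]%classic,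
        convex_function (reach k) (lo k),
        convex_function (reach k) (fun x => - hi k x),
        locally_lipschitz (reach k) (lo k)
      & locally_lipschitz (reach k) (hi k)].

End Problem.

(* In every field the first index is the loop p and the second the stage k. *)
Record rddp_data (R : realType) (m : nat) := RddpData {
  samples : nat -> nat -> set (state R m);
  vhat : nat -> nat -> state R m -> R;
  vapp : nat -> nat -> state R m -> R;
  subgrad : nat -> nat -> state R m -> state R m;
  traj : nat -> nat -> state R m;
  ctrl : nat -> nat -> R }.

Section Process.
Context {R : realType} {m N : nat} (P : path_problem R m N).
Variable D : rddp_data R m.

Definition samples_ok := forall p k, (k < N)%N ->
  [/\ finite_set (samples D p k), samples D p k !=set0
    & samples D p k `<=` reach P k].

(* The minimum over the compact set [controls P k x] is written inf, so that
   its attainment is not an additional hypothesis; the maximum over the finite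
   nonempty set of samples is written sup. *)
Definition backward_pass p :=
  (forall x, reach P N x -> vapp D p N x = final_cost P x) /\
  forall k, (k < N)%N ->
    [/\ forall x, reach P k x ->
          vhat D p k x =
            inf [set stage_cost P k (x, u) + vapp D p k.+1 (next_state P k x u)
                | u in controls P k x],
        forall y, samples D p k y ->
          clarke_subdifferential (reach P k) (vhat D p k) y (subgrad D p k y)
      & forall x, reach P k x ->
          vapp D p k x =
            sup [set vhat D p k y + dotv (subgrad D p k y) (x - y)
                | y in samples D p k]].

Definition forward_pass p :=
  argmin (reach P 0 `&` init_set P) (vapp D p 0) (traj D p 0) /\
  forall k, (k < N)%N ->
    argmin (controls P k (traj D p k))
      (fun u => stage_cost P k (traj D p k, u)
                + vapp D p k.+1 (next_state P k (traj D p k) u))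
      (ctrl D p k) /\
    traj D p k.+1 = next_state P k (traj D p k) (ctrl D p k).

(* That the new sample sets are finite subsets of [reach P k] is part of
   [samples_ok]. *)
Definition samples_update p := forall k, (k < N)%N ->
  samples D p k `|` [set traj D p k] `<=` samples D p.+1 k.

Definition rddp :=
  samples_ok /\
  forall p, [/\ backward_pass p, forward_pass p & samples_update p].

Definition eps_gap p : R :=
  total_cost P (traj D p) (ctrl D p) - vapp D p 0 (traj D p 0).

End Process.

(* Main.v *)
(* A Clarke subgradient of a convex function is a global subgradient, also at
   boundary points of the domain, as soon as the function is lower
   semicontinuous there: the gradient inequality holds at the points of
   differentiability and passes to the limit and to convex combinations.  By
   backward induction every V_k^p is convex, lower semicontinuous and below the
   cost to go of each feasible trajectory: the Bellman operator preserves the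
   three properties, and a cut approximation lies below what it approximates.
   Hence V_0^p(x_0) <= J_0 for every feasible trajectory, and the minimizing
   property of x_0^{p*} turns this into V_0^p(x_0^{p*}) <= J^*. *)
Require Import Defs.
From HB Require Import structures.
From mathcomp Require Import all_boot all_order all_algebra.
From mathcomp Require Import all_classical all_reals all_analysis.
From mathcomp Require Import lra.

Set Implicit Arguments.
Unset Strict Implicit.
Unset Printing Implicit Defensive.

Import Order.TTheory GRing.Theory Num.Theory.
Import numFieldNormedType.Exports.

Local Open Scope classical_set_scope.
Local Open Scope ring_scope.

(** * Convexity with real weights in the unit interval *)

Section Convexity.
Context {R : realType}.

Lemma convex_setP (V : lmodType R) (A : set V) :
  convex_set A <-> forall x y (l : R), A x -> A y -> 0 <= l <= 1 ->
    A (l *: x + (1 - l) *: y).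
Proof.
split=> [cA x y l Ax Ay /andP[l0 l1]|cA x y l /set_mem Ax /set_mem Ay].
  by have := cA x y (Itv01 l0 l1) (mem_set Ax) (mem_set Ay) => /set_mem.
by apply/mem_set/cA => //; rewrite ge0 le1.
Qed.

Lemma convex_functionP (V : lmodType R) (A : set V) (f : V -> R) :
  convex_function A f <-> forall x y (l : R), A x -> A y -> 0 <= l <= 1 ->
    f (l *: x + (1 - l) *: y) <= l * f x + (1 - l) * f y.
Proof.
split=> [cf x y l Ax Ay /andP[l0 l1]|cf l x y /set_mem Ax /set_mem Ay].
  exact: cf (Itv01 l0 l1) x y (mem_set Ax) (mem_set Ay).
by apply: cf => //; rewrite ge0 le1.
Qed.

End Convexity.

(** * Limits of Lipschitz functions, matrices, sums and scalar products *)

Section Continuity.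
Context {R : realType}.

Lemma locally_lipschitz_cvg (V W : normedModType R) (A : set V) (f : V -> W) x :
  locally_lipschitz A f -> A x -> f z @[z --> within A (nbhs x)] --> f x.
Proof.
move=> lf Ax; have [U Ux] := lf x Ax.
rewrite /lipschitz_on => /pinfty_ex_gt0[M /= M0 lipM].
apply/cvgrPdist_le => e e0.
rewrite near_withinE; near=> z => Az.
have Uz : U z by near: z.
have := lipM (x, z) (conj (conj Ax (nbhs_singleton Ux)) (conj Az Uz)) => /= h.
rewrite (le_trans h)// -ler_pdivlMl//.
near: z; apply: cvgr_dist_le; first exact: cvg_id.
by rewrite mulr_gt0// invr_gt0.
Unshelve. all: end_near. Qed.

Lemma cvg_mx (T : Type) (F : set_system T) (m n : nat)
    (f : T -> 'M[R]_(m, n)) (M : 'M[R]_(m, n)) : Filter F ->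
  (forall i j, f x i j @[x --> F] --> M i j) -> f x @[x --> F] --> M.
Proof.
move=> FF fM; apply/cvg_ballP => e e0.
have : \forall x \near F, forall i j, ball (M i j) e (f x i j).
  apply: filter_forall => i; apply: filter_forall => j.
  by have /cvg_ballP := fM i j; apply.
by apply: filterS => x; split.
Qed.

Lemma cvg_sumr (T : Type) (F : set_system T) (I : Type) (r : seq I)
    (f : I -> T -> R) (a : I -> R) : Filter F ->
  (forall i, f i x @[x --> F] --> a i) ->
  \sum_(i <- r) f i x @[x --> F] --> \sum_(i <- r) a i.
Proof.
move=> FF fa.
have addc : continuous (fun x : R * R => x.1 + x.2).
  by move=> [a1 a2]; apply: cvgD; [exact: cvg_fst|exact: cvg_snd].
by apply: (cvg_big addc) => i _.
Qed.

Lemma dotvE n (v w : 'cV[R]_n) : dotv v w = \sum_i v i 0 * w i 0.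
Proof. by rewrite /dotv mxE; apply: eq_bigr => i _; rewrite mxE. Qed.

Lemma cvg_dotv (T : Type) (F : set_system T) n (f g : T -> 'cV[R]_n)
    (a b : 'cV[R]_n) :
  Filter F -> f x @[x --> F] --> a -> g x @[x --> F] --> b ->
  dotv (f x) (g x) @[x --> F] --> dotv a b.
Proof.
move=> FF fa gb; rewrite dotvE; under eq_fun do rewrite dotvE.
apply: cvg_sumr => i.
apply: cvgM.
- exact: (cvg_comp _ (fun M : 'cV[R]_n => M i 0) fa
    (@coord_continuous R n 1 i 0 a)).
- exact: (cvg_comp _ (fun M : 'cV[R]_n => M i 0) gb
    (@coord_continuous R n 1 i 0 b)).
Qed.

End Continuity.

(** * Lower semicontinuity relative to a set *)

Section Semicontinuity.
Context {R : realType}.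

(** Neighbourhoods are taken within [A] because the backward pass prescribes [vhat] and [vapp] on
    reachable sets only; elsewhere their values are arbitrary. *)
Definition lsc_on (V : topologicalType) (A : set V) (f : V -> R) :=
  forall x a, A x -> a < f x -> \forall z \near within A (nbhs x), a < f z.

Lemma lsc_onS (V : topologicalType) (A B : set V) (f : V -> R) :
  B `<=` A -> lsc_on A f -> lsc_on B f.
Proof.
move=> BA fA x a /BA Ax afx; have := fA x a Ax afx.
by rewrite !near_withinE; apply: filterS => z h /BA; exact: h.
Qed.

Lemma eq_lsc_on (V : topologicalType) (A : set V) (f g : V -> R) :
  (forall x, A x -> f x = g x) -> lsc_on A f -> lsc_on A g.
Proof.
move=> fg fA x a Ax; rewrite -fg// => afx; have := fA x a Ax afx.
by rewrite !near_withinE; apply: filterS => z h Az; rewrite -fg//; exact: h.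
Qed.

Lemma cvg_lsc_on (V : topologicalType) (A : set V) (f : V -> R) :
  (forall x, A x -> f z @[z --> within A (nbhs x)] --> f x) -> lsc_on A f.
Proof. by move=> fA x a Ax afx; exact: cvgr_gt (fA x Ax) _ afx. Qed.

Lemma lsc_on_comp (U V : topologicalType) (A : set U) (B : set V)
    (g : U -> V) (f : V -> R) :
  continuous g -> (forall x, A x -> B (g x)) -> lsc_on B f ->
  lsc_on A (f \o g).
Proof.
move=> cg gAB fB x a Ax afx; have := fB (g x) a (gAB x Ax) afx.
rewrite !near_withinE => h0.
have : \forall z \near x, B (g z) -> a < f (g z) by exact: cg x _ h0.
by apply: filterS => z h Az; exact/h/gAB.
Qed.

Lemma lsc_onD (V : topologicalType) (A : set V) (f g : V -> R) :
  lsc_on A f -> lsc_on A g -> lsc_on A (fun x => f x + g x).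
Proof.
move=> fA gA x a Ax afg; set d := (f x + g x - a) / 2.
have fd : f x - d < f x by rewrite /d; lra.
have gd : g x - d < g x by rewrite /d; lra.
have := gA x _ Ax gd; apply: filterS2 (fA x _ Ax fd) => z.
by rewrite /d; lra.
Qed.

(** Around each [x] in [K] the values stay above [f x - 1], so every large [M] has [- M] as a local
    lower bound; compactness makes one [M] work on all of [K]. *)
Lemma lsc_on_compact_lbound (V : topologicalType) (K : set V) (f : V -> R) :
  compact K -> lsc_on K f -> has_lbound (f @` K).
Proof.
move=> /compact_near_coveringP cK fK.
have : \forall M \near +oo, K `<=` (fun x => K x -> - M < f x).
  apply: cK => x Kx.
  have fx1 : f x - 1 < f x by lra.
  have := fK x _ Kx fx1; rewrite near_withinE => h.
  exists ([set z | K z -> f x - 1 < f z], [set M | - (f x - 1) < M]).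
    by split => //=; exact/nbhs_pinfty_gt/num_real.
  by move=> [z M] /= [zf xM] /zf; lra.
move=> /pinfty_ex_gt0[M _ hM]; exists (- M) => _ [x Kx <-].
exact/ltW/hM.
Qed.

End Semicontinuity.

(** * Clarke subgradients of convex functions are global subgradients *)

Section Cuts.
Context {R : realType} {n : nat}.
Implicit Types (B S : set 'cV[R]_n) (f : 'cV[R]_n -> R) (x y z v : 'cV[R]_n).

Lemma dotvDr v x y : dotv v (x + y) = dotv v x + dotv v y.
Proof. by rewrite /dotv mulmxDr mxE. Qed.

Lemma dotvZr v (l : R) x : dotv v (l *: x) = l * dotv v x.
Proof. by rewrite /dotv -scalemxAr mxE. Qed.

Lemma dotv_suml (I : Type) (r : seq I) (w : I -> R) (a : I -> 'cV[R]_n) x :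
  dotv (\sum_(i <- r) w i *: a i) x = \sum_(i <- r) w i * dotv (a i) x.
Proof.
rewrite /dotv linear_sum /= mulmx_suml summxE; apply: eq_bigr => i _.
by rewrite linearZ /= -scalemxAl mxE.
Qed.

Lemma sub_affine_hull B : B `<=` affine_hull B.
Proof.
move=> x Bx; exists 1%N, (fun=> 1), (fun=> x).
by split => //; rewrite big_ord1 ?scale1r.
Qed.

(** Move from [x] towards [z] by a small fraction [l]. Convexity bounds the increment of [f] above
    by [l * (f z - f x)], the gradient bounds it below by [l * dotv v (z - x)] up to [l * e]; then
    divide by [l]. *)
Lemma relative_gradient_le B f x v z : convex_set B -> convex_function B f ->
  B x -> B z -> relative_gradient B f x v -> f x + dotv v (z - x) <= f z.
Proof.
move=> cB cf Bx Bz [_ grad].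
apply/ler_addgt0Pr => e e0.
(* With accuracy [e / c] the error at fraction [l] is at most [l * e]; the summand 1 keeps the
   divisor positive when [z = x]. *)
pose c := `|z - x| + 1.
have c0 : 0 < c by rewrite /c ltr_wpDl.
have ec0 : 0 < e / c by rewrite divr_gt0.
have := grad _ ec0; rewrite near_withinE => /= near_grad.
have cvg_x : x + l *: (z - x) @[l --> (0 : R)^'+] --> x.
  rewrite -[X in _ --> X]addr0 -(scale0r (z - x)).
  apply: cvgD; first exact: cvg_cst.
  by apply: cvgZr_tmp; exact: cvg_at_right_filter.
have [l [l0 l1 hl]] : exists l : R, [/\ 0 < l, l <= 1 &
    affine_hull B (x + l *: (z - x)) -> `|f (x + l *: (z - x)) - f x -
      dotv v (x + l *: (z - x) - x)| <= e / c * `|x + l *: (z - x) - x|].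
  near (0 : R)^'+ => l; exists l; split => //.
  by near: l; exact: nbhs_right_le.
  by near: l; exact: cvg_x near_grad.
have convE : x + l *: (z - x) = l *: z + (1 - l) *: x.
  by rewrite scalerBr scalerBl scale1r addrCA.
have l01 : 0 <= l <= 1 by rewrite l1 ltW.
have Bl : B (x + l *: (z - x)) by rewrite convE; exact/(iffLR (convex_setP _)).
have := hl (sub_affine_hull Bl); rewrite [x + _ - x]addrAC subrr add0r.
rewrite normrZ gtr0_norm// dotvZr ler_norml => /andP[+ _].
have := iffLR (convex_functionP _ _) cf z x l Bz Bx l01; rewrite -convE.
rewrite [e / c * _]mulrCA => hf hg.
have hq : e / c * `|z - x| <= e.
  by rewrite mulrAC ler_pdivrMr// ler_wpM2l ?(ltW e0)// /c lerDl.
have : l * (e / c * `|z - x|) <= l * e by rewrite ler_wpM2l// ltW.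
move=> hle; rewrite -(ler_pM2l l0); lra.
Unshelve. all: end_near. Qed.

Lemma clarke_subdifferential_le B f y g z :
  convex_set B -> convex_function B f -> lsc_on B f -> B y -> B z ->
  clarke_subdifferential B f y g -> f y + dotv g (z - y) <= f z.
Proof.
move=> cB cf lf By Bz [d [w [a [w0 w1 ha ->]]]].
(* The inequality is affine in the subgradient and the weights sum to 1, so it is enough to treat a
   single limit of gradients. *)
suff le_a i : f y + dotv (a i) (z - y) <= f z.
  rewrite dotv_suml -[f y]mul1r -[f z]mul1r -w1 !mulr_suml -big_split/=.
  by apply: ler_sum => i _; rewrite -mulrDr ler_wpM2l.
have [s [t [sB st sy ta]]] := ha i.
(* Half of [e] pays for replacing [f y] by [f (s j)], where lower semicontinuity gives the needed
   side, and half for the limit of the scalar products. *)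
apply/ler_addgt0Pr => e e0.
have cvg_dot : dotv (t j) (z - s j) @[j --> \oo] --> dotv (a i) (z - y).
  by apply: cvg_dotv => //; apply: cvgB => //; exact: cvg_cst.
have ye : f y - e / 2 < f y by lra.
have := lf y _ By ye; rewrite near_withinE => near_y.
have near_f : \forall j \near \oo, f y - e / 2 < f (s j).
  have : \forall j \near \oo, B (s j) -> f y - e / 2 < f (s j) := sy _ near_y.
  by apply: filterS => j; apply; have [] := sB j.
have ae : dotv (a i) (z - y) - e / 2 < dotv (a i) (z - y) by lra.
have near_dot := cvgr_gt _ cvg_dot _ ae.
near \oo => j.
have Bs : B (s j) by have [] := sB j.
have := relative_gradient_le cB cf Bs Bz (st j).
have : f y - e / 2 < f (s j) by near: j; exact: near_f.
have : dotv (a i) (z - y) - e / 2 < dotv (t j) (z - s j).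
  by near: j; exact: near_dot.
lra.
Unshelve. all: end_near. Qed.

End Cuts.

(** * Finite pointwise suprema *)

Section Pointwise_supremum.
Context {R : realType} {V : normedModType R} {T : choiceType}.
Variables (S : set T) (B : set V) (c : T -> V -> R).
Hypotheses (finS : finite_set S) (S0 : S !=set0).

Lemma has_ubound_finite (A : set R) : finite_set A -> has_ubound A.
Proof.
move=> /finite_seqP[s ->]; elim: s => [|a s [M hM]]; first by exists 0.
exists (Num.max a M) => x /=; rewrite inE => /orP[/eqP ->|xs].
  by rewrite le_max lexx.
by rewrite le_max hM ?orbT.
Qed.

Let f x := sup [set c y x | y in S].

Lemma ge_sup_finite x y : S y -> c y x <= f x.
Proof.
move=> Sy; apply: ub_le_sup; last by exists y.
exact/has_ubound_finite/finite_image.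
Qed.

(** Nonemptiness of [S] matters here: the supremum of the empty set is 0 by default. *)
Lemma sup_finite_le x (M : R) : (forall y, S y -> c y x <= M) -> f x <= M.
Proof.
move=> cM; apply: ge_sup => [|_ [y Sy <-]]; last exact: cM.
by have [y Sy] := S0; exists (c y x), y.
Qed.

Lemma convex_function_sup : (forall y, S y -> convex_function B (c y)) ->
  convex_function B f.
Proof.
move=> cc; apply/convex_functionP => x z l Bx Bz /andP[l0 l1].
apply: sup_finite_le => y Sy.
have := iffLR (convex_functionP _ _) (cc y Sy) x z l Bx Bz.
rewrite l0 l1 => /(_ isT) /le_trans; apply.
by rewrite lerD// ler_wpM2l ?subr_ge0 ?ge_sup_finite.
Qed.

Lemma lsc_on_sup : (forall y, S y -> lsc_on B (c y)) -> lsc_on B f.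
Proof.
move=> cc x a Bx /sup_gt[|_ [y Sy <-] acy].
  by have [y Sy] := S0; exists (c y x), y.
apply: filterS (cc y Sy x a Bx acy) => z /lt_le_trans; apply.
exact: ge_sup_finite.
Qed.

End Pointwise_supremum.

(** * Minimization over an interval depending on the state *)

Section Partial_minimization.
Context {R : realType} {V : normedModType R}.
Variables (B : set V) (lo hi : V -> R) (F : V * R -> R).
Hypotheses (lohi : forall x, B x -> lo x <= hi x)
  (lo_lip : locally_lipschitz B lo) (hi_lip : locally_lipschitz B hi).

Let G : set (V * R) := [set z | B z.1 /\ `[lo z.1, hi z.1]%classic z.2].

Hypothesis F_lsc : lsc_on G F.

Let f x := inf [set F (x, u) | u in `[lo x, hi x]%classic].

(** An infimum can be compared with the values only once they are known to be bounded below; here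
    the slice of [F] at [x] is lower semicontinuous on a compact segment. *)
Lemma partial_min_has_lbound x : B x ->
  has_lbound [set F (x, u) | u in `[lo x, hi x]%classic].
Proof.
move=> Bx; have F_lscx : lsc_on `[lo x, hi x] (F \o pair x).
  apply: lsc_on_comp F_lsc => // u.
  apply: (@cvg_pair _ _ _ (nbhs u) (nbhs x) (nbhs u) _ _ _ (fun=> x) id).
    exact: cvg_cst.
  exact: cvg_id.
exact: lsc_on_compact_lbound (@segment_compact _ _ _) F_lscx.
Qed.

Let partial_min_nonempty x : B x ->
  [set F (x, u) | u in `[lo x, hi x]%classic] !=set0.
Proof.
by move=> Bx; exists (F (x, lo x)), (lo x); rewrite //= in_itv /= lexx lohi.
Qed.

Lemma partial_min_le x u : B x -> lo x <= u <= hi x -> f x <= F (x, u).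
Proof.
move=> Bx xu; apply: ge_inf; first exact: partial_min_has_lbound.
by exists u => //=; rewrite in_itv.
Qed.

(** Convexity of [G] makes the combination of a control [u] for [x] and a control [v] for [y]
    admissible at the combined state. Taking [u] and [v] within [e] of the infima avoids any appeal
    to minimizers. *)
Lemma convex_function_partial_min :
  convex_set G -> convex_function G F -> convex_function B f.
Proof.
move=> cG cF; apply/convex_functionP => x y l Bx By l01.
have /andP[l0 l1] := l01.
apply/ler_addgt0Pr => e e0.
have fin z : B z -> has_inf [set F (z, u) | u in `[lo z, hi z]%classic].
  by move=> Bz; split;
    [exact: partial_min_nonempty|exact: partial_min_has_lbound].
have [_ [u xu <-] Fu] := inf_adherent e0 (fin x Bx).
have [_ [v yv <-] Fv] := inf_adherent e0 (fin y By).
have Gx : G (x, u) by [].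
have Gy : G (y, v) by [].
have [/= Bl ul] := iffLR (convex_setP _) cG _ _ _ Gx Gy l01.
have := iffLR (convex_functionP _ _) cF _ _ _ Gx Gy l01.
have : f (l *: x + (1 - l) *: y) <= F (l *: (x, u) + (1 - l) *: (y, v)).
  by apply: partial_min_le => //; move: ul; rewrite in_itv.
rewrite -/(f x) -/(f y) in Fu Fv *.
move=> h1 h2.
have h3 : l * F (x, u) <= l * (f x + e) by rewrite ler_wpM2l// ltW.
have h4 : (1 - l) * F (y, v) <= (1 - l) * (f y + e).
  by rewrite ler_wpM2l ?subr_ge0// ltW.
lra.
Qed.

(* Reparametrizing the moving interval [lo x, hi x] by [0, 1] turns the claim
   into a covering argument on a fixed compact set. *)
Lemma lsc_on_partial_min : lsc_on B f.
Proof.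
(* A strict bound on every value gives only a weak bound on the infimum, hence the intermediate
   level [b], strictly between [a] and [f y]. *)
move=> y a By afy; pose b := (a + f y) / 2.
have ab : a < b by rewrite /b; lra.
have bf : b < f y by rewrite /b; lra.
pose phi (x : V) (t : R) := lo x + t * (hi x - lo x).
have phiG x t : B x -> 0 <= t <= 1 -> lo x <= phi x t <= hi x.
  move=> Bx /andP[t0 t1]; have := lohi Bx.
  by rewrite /phi => lh; apply/andP; split; nra.
have phi_onto x u : B x -> lo x <= u <= hi x ->
    exists2 t, 0 <= t <= 1 & u = phi x t.
  move=> Bx /andP[lu uh]; have := lohi Bx; rewrite le_eqVlt => /orP[/eqP lh|lh].
    (* The interval is a single point, where the quotient used below would divide by zero. *)
    by exists 0; rewrite ?lexx ?ler01// /phi; lra.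
  have d0 : 0 < hi x - lo x by rewrite subr_gt0.
  exists ((u - lo x) / (hi x - lo x)).
    by rewrite divr_ge0 ?subr_ge0 ?(ltW lh)//= ler_pdivrMr// mul1r lerB.
  by rewrite /phi divfK ?gt_eqF// addrC subrK.
have /compact_near_coveringP cov := @segment_compact R 0 1.
(* Here [t] runs over the compact set and [x] is the parameter: compactness yields a neighbourhood
   of [y] that serves all [t] at once. *)
have near_b : \forall x \near within B (nbhs y), `[0, 1]%classic `<=`
    (fun t : R => B x -> 0 <= t <= 1 -> b < F (x, phi x t)).
  apply: cov => t /=; rewrite in_itv /= => t01.
  have bF : b < F (y, phi y t).
    by apply: lt_le_trans bf _; apply: partial_min_le => //; exact: phiG.
  have Gy : G (y, phi y t) by split => //=; rewrite in_itv /= phiG.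
  have := F_lsc Gy bF; rewrite near_withinE => near_F.
  (* Continuity of the endpoints makes [phi] jointly continuous, so the semicontinuity of [F] at
     [(y, phi y t)] can be pulled back to pairs near [(t, y)]. *)
  have cvg_phi : (z.2, phi z.2 z.1) @[z --> (nbhs t, within B (nbhs y))] -->
      (y, phi y t).
    have cvg2 : z.2 @[z --> (nbhs t, within B (nbhs y))] --> within B (nbhs y).
      exact: cvg_snd.
    have cvg1 : z.1 @[z --> (nbhs t, within B (nbhs y))] --> t.
      exact: cvg_fst.
    have cvglo : lo z.2 @[z --> (nbhs t, within B (nbhs y))] --> lo y.
      exact: cvg_comp cvg2 (locally_lipschitz_cvg lo_lip By).
    have cvghi : hi z.2 @[z --> (nbhs t, within B (nbhs y))] --> hi y.
      exact: cvg_comp cvg2 (locally_lipschitz_cvg hi_lip By).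
    apply: (@cvg_pair _ _ _ _ (nbhs y) (nbhs (phi y t)) _ _ _ snd
      (fun z : R * V => phi z.2 z.1)).
      by apply: cvg_trans cvg2 _; exact: cvg_within.
    by apply: cvgD => //; apply: cvgM => //; apply: cvgB.
  have : \forall z \near (nbhs t, within B (nbhs y)),
      G (z.2, phi z.2 z.1) -> b < F (z.2, phi z.2 z.1).
    exact: cvg_phi near_F.
  apply: filterS => -[s x] /= h Bx s01; apply: h.
  by split => //=; rewrite in_itv /= phiG.
move: near_b; rewrite !near_withinE; apply: filterS => x near_b Bx.
apply: lt_le_trans ab _; apply: lb_le_inf; first exact: partial_min_nonempty.
move=> _ [u + <-]; rewrite /= in_itv /= => /(phi_onto x u Bx)[t t01 ->].
by apply/ltW/near_b => //=; rewrite in_itv.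
Qed.

End Partial_minimization.

(** * Reachable sets, admissible controls and their convexity *)

Section Path_problem.
Context {R : realType} {m N : nat} (P : path_problem R m N).
Implicit Types (x y : state R m) (u v : R) (k : nat).

Lemma follows_reach k j xs us : (k <= j)%N -> follows P k xs us ->
  final_set P (xs N) -> reach P j (xs j).
Proof.
move=> kj fxu fN; exists xs, us; split => // i /andP[ji iN].
by apply: fxu; rewrite (leq_trans kj ji).
Qed.

Lemma reach_state_ok k x : (k < N)%N -> reach P k x -> state_ok P k x.
Proof.
by move=> kN [xs [us [<- fxu _]]]; have [|] := fxu k _; rewrite ?leqnn.
Qed.

Lemma follows_controls k xs us : (k < N)%N -> follows P k xs us ->
  final_set P (xs N) -> controls P k (xs k) (us k).
Proof.
move=> kN fxu fN; have [|e _ ok] := fxu k _; first by rewrite leqnn.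
by split => //; rewrite -e; exact: follows_reach (leqnSn k) fxu fN.
Qed.

Lemma next_state_convex k x y u v (l : R) :
  next_state P k (l *: x + (1 - l) *: y) (l * u + (1 - l) * v) =
  l *: next_state P k x u + (1 - l) *: next_state P k y v.
Proof.
rewrite /next_state mulmxDr -!scalemxAr !scalerDr scalerDl !scalerA.
by rewrite addrACA.
Qed.

Lemma continuous_next_state k :
  continuous (fun z : state R m * R => next_state P k z.1 z.2).
Proof.
move=> [x u]; apply: cvgD; last first.
  by apply: cvgZr_tmp; exact: cvg_snd.
apply: cvg_mx => i j; rewrite mxE; under eq_fun do rewrite mxE.
apply: cvg_sumr => q; apply: cvgM; first exact: cvg_cst.
apply: (cvg_comp fst (fun M : state R m => M q j)); first exact: cvg_fst.
exact: coord_continuous.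
Qed.

Hypothesis copp : is_copp P.

Lemma convex_state_ok k x y (l : R) : (k < N)%N -> state_ok P k x ->
  state_ok P k y -> 0 <= l <= 1 -> state_ok P k (l *: x + (1 - l) *: y).
Proof.
move=> kN okx oky l01 i; have [/(_ k kN)[_ cf _] _ _ _ _] := copp.
have := iffLR (convex_functionP _ _) (cf i) x y l I I l01.
have /andP[l0 l1] := l01.
by have := okx i; have := oky i; nra.
Qed.

Lemma convex_control_ok k x y u v (l : R) : (k < N)%N -> control_ok P k x u ->
  control_ok P k y v -> 0 <= l <= 1 ->
  control_ok P k (l *: x + (1 - l) *: y) (l * u + (1 - l) * v).
Proof.
move=> kN okx oky l01 i; have [/(_ k kN)[_ _ ch] _ _ _ _] := copp.
have := iffLR (convex_functionP _ _) (ch i) (x, u) (y, v) l I I l01.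
have /andP[l0 l1] := l01.
by have := okx i; have := oky i; nra.
Qed.

(** Two witnessing trajectories are combined stage by stage: the dynamics are linear in state and
    control jointly, and the stage constraints and the terminal set are convex. *)
Lemma convex_reach k x y (l : R) : reach P k x -> reach P k y ->
  0 <= l <= 1 -> reach P k (l *: x + (1 - l) *: y).
Proof.
move=> [xs [us [<- fx xN]]] [ys [vs [<- fy yN]]] l01.
exists (fun j => l *: xs j + (1 - l) *: ys j),
  (fun j => l * us j + (1 - l) * vs j).
split => // [j kjN|]; last first.
  by have [_ _ _ cfin _] := copp; exact/(iffLR (convex_setP _) cfin).
have [xS okx ox] := fx j kjN; have [yS oky oy] := fy j kjN.
have /andP[_ jN] := kjN.
split; first by rewrite next_state_convex xS yS.
  exact: convex_state_ok.
exact: convex_control_ok.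
Qed.

(** The control constraints are jointly convex, and the condition on the next state is the preimage
    of a convex reachable set under a linear map. *)
Lemma convex_controls_graph k : (k < N)%N ->
  convex_set [set z | reach P k z.1 /\ controls P k z.1 z.2].
Proof.
move=> kN; apply/convex_setP => -[x u] [y v] l /= [rx [ox nx]] [ry [oy ny]] l01.
split; first exact: (convex_reach rx ry l01).
split; first exact: (convex_control_ok kN ox oy l01).
rewrite /= next_state_convex.
exact: (convex_reach nx ny l01).
Qed.

End Path_problem.

(** * The invariant of the backward pass *)

Section Cost_to_go.
Context {R : realType} {m N : nat} (P : path_problem R m N).
Hypotheses (reg : regular P) (copp : is_copp P) (adm : admissible_controls P).

Definition cost_to_go k (xs : nat -> state R m) (us : nat -> R) : R :=
  \sum_(k <= j < N) stage_cost P j (xs j, us j) + final_cost P (xs N).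

(** The first two clauses are what makes Clarke cuts global minorants. The lower bound is stated
    along trajectories, so that no exact value function has to be introduced. *)
Definition tame k (V : state R m -> R) :=
  [/\ convex_function (reach P k) V, lsc_on (reach P k) V
    & forall xs us, follows P k xs us -> final_set P (xs N) ->
        V (xs k) <= cost_to_go k xs us].

(** The admissible-control assumption turns the infimum over [controls] into one over an interval
    with locally Lipschitz endpoints, which is a partial minimization. The cost bound follows by
    trying the trajectory's own control at stage [k]. *)
Lemma bellman_tame k (V W : state R m -> R) : (k < N)%N -> tame k.+1 V ->
  (forall x, reach P k x -> W x =
    inf [set stage_cost P k (x, u) + V (next_state P k x u)
        | u in controls P k x]) ->
  tame k W.
Proof.
move=> kN [cV lV leV] WE.
have [costs _ _ _ _] := reg; have [Llip _ _] := costs k kN.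
have [ccosts _ _ _ _] := copp; have [Lconv _ _] := ccosts k kN.
have [los [his /(_ k kN)]] := adm.
move: (los k) (his k) => lo hi [ctrlE _ _ lo_lip hi_lip].
pose G := [set z : state R m * R |
  reach P k z.1 /\ `[lo z.1, hi z.1]%classic z.2].
(* The interval form of the graph fits the partial minimization; the [controls] form gives its
   convexity and the reachability of the next state. *)
have GE : G = [set z | reach P k z.1 /\ controls P k z.1 z.2].
  by apply/seteqP; split => -[x u] [rx xu]; split => //; move: xu;
    rewrite [(_, _).1]/= [(_, _).2]/= ctrlE.
pose F (z : state R m * R) := stage_cost P k z + V (next_state P k z.1 z.2).
have cG : convex_set G by rewrite GE; exact: convex_controls_graph.
have nextG z : G z -> reach P k.+1 (next_state P k z.1 z.2).
  by rewrite GE => -[_ []].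
have F_lsc : lsc_on G F.
  apply: lsc_onD.
    apply: (@lsc_onS _ _ setT) => //; apply: cvg_lsc_on => z _.
    exact: locally_lipschitz_cvg.
  exact: (lsc_on_comp (@continuous_next_state _ _ _ P k) nextG lV).
have F_conv : convex_function G F.
  apply/convex_functionP => z z' l Gz Gz' l01.
  have := iffLR (convex_functionP _ _) Lconv z z' l I I l01.
  have := iffLR (convex_functionP _ _) cV _ _ l (nextG _ Gz) (nextG _ Gz') l01.
  by rewrite -next_state_convex /F; case: z z' {Gz Gz'} => [x u] [y v] /=; lra.
(* A reachable state carries a trajectory, whose control at stage [k] lies in the interval. *)
have lohi x : reach P k x -> lo x <= hi x.
  move=> [xs [us [<- fxu fN]]]; have := follows_controls kN fxu fN.
  rewrite ctrlE; last exact: follows_reach (leqnn k) fxu fN.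
  by rewrite /= in_itv /= => /andP[]; exact: le_trans.
have WE' x : reach P k x ->
    inf [set F (x, u) | u in `[lo x, hi x]%classic] = W x.
  by move=> rx; rewrite WE// ctrlE.
split.
- have := convex_function_partial_min lohi F_lsc cG F_conv.
  move=> /convex_functionP h; apply/convex_functionP => x y l rx ry l01.
  rewrite -!WE'//; first exact: h.
  exact: convex_reach.
- apply: eq_lsc_on WE' _; exact: lsc_on_partial_min.
move=> xs us fxu fN.
have rk := follows_reach (leqnn k) fxu fN.
have fxuS : follows P k.+1 xs us.
  by move=> j /andP[kj jN]; apply: fxu; rewrite (ltnW kj).
rewrite -WE'// /cost_to_go big_ltn// -addrA.
have := follows_controls kN fxu fN; rewrite ctrlE// /= in_itv /= => cu.
apply: le_trans (partial_min_le F_lsc rk cu) _.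
rewrite /F lerD2l /=.
have [|<- _ _] := fxu k; first by rewrite leqnn.
exact: leV.
Qed.

(** Each cut is affine, so the finite maximum is convex and lower semicontinuous. Each cut lies
    below [W] on the reachable set, so [V] inherits the cost bound of [W]. *)
Lemma tame_cuts k (W V : state R m -> R) (S : set (state R m))
    (g : state R m -> state R m) : tame k W -> finite_set S -> S !=set0 ->
  S `<=` reach P k ->
  (forall y, S y -> clarke_subdifferential (reach P k) W y (g y)) ->
  (forall x, reach P k x ->
    V x = sup [set W y + dotv (g y) (x - y) | y in S]) ->
  tame k V.
Proof.
move=> [cW lW leW] finS S0 Sr clarke VE.
pose c y x := W y + dotv (g y) (x - y).
have cr : convex_set (reach P k) by apply/convex_setP => *; exact: convex_reach.
have cE x y z l : c y (l *: x + (1 - l) *: z) = l * c y x + (1 - l) * c y z.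
  rewrite /c !dotvDr !dotvZr; lra.
split.
- have /convex_functionP h : convex_function (reach P k)
      (fun x => sup [set c y x | y in S]).
    apply: convex_function_sup => // y _; apply/convex_functionP => x z l *.
    by rewrite cE.
  apply/convex_functionP => x y l rx ry l01.
  by rewrite !VE//; [exact: h|exact: convex_reach].
- apply: (@eq_lsc_on _ _ _ (fun x => sup [set c y x | y in S])).
    by move=> x /VE.
  apply: lsc_on_sup => // y _; apply: cvg_lsc_on => x _.
  apply: cvgD; first exact: cvg_cst.
  apply: cvg_dotv; first exact: cvg_cst.
  by apply: cvgB; [exact: cvg_within|exact: cvg_cst].
move=> xs us fxu fN; apply: le_trans (leW xs us fxu fN).
have rk := follows_reach (leqnn k) fxu fN.
rewrite VE//; apply: (@sup_finite_le _ _ _ S c) => // y Sy.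
exact: clarke_subdifferential_le (Sr y Sy) rk (clarke y Sy).
Qed.

Lemma final_cost_tame (V : state R m -> R) :
  (forall x, reach P N x -> V x = final_cost P x) -> tame N V.
Proof.
move=> VE; have [_ Plip _ _ _] := reg; have [_ Pconv _ _ _] := copp.
split.
- apply/convex_functionP => x y l rx ry l01.
  rewrite !VE//; last exact: convex_reach.
  exact: (iffLR (convex_functionP _ _) Pconv x y l I I l01).
- apply: (@eq_lsc_on _ _ _ (final_cost P)) => [x /VE //|].
  apply: (@lsc_onS _ _ setT) => //; apply: cvg_lsc_on => z _.
  exact: locally_lipschitz_cvg.
- move=> xs us fxu fN; rewrite /cost_to_go big_geq// add0r VE//.
  exact: follows_reach (leqnn N) fxu fN.
Qed.

Lemma vapp_tame (D : rddp_data R m) p : samples_ok P D -> backward_pass P D p ->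
  forall k, (k <= N)%N -> tame k (vapp D p k).
Proof.
move=> sok [vN bwd] k kN.
(* Backward induction on the stage becomes ordinary induction on the number of remaining stages. *)
rewrite -(subKn kN); move: (N - k)%N (leq_subr k N) => {kN}k.
elim: k => [|d ih] dN; first by rewrite subn0; exact: final_cost_tame.
have dN' : (N - d.+1 < N)%N by rewrite ltn_subrL (leq_ltn_trans _ dN).
have [vE clarke cuts] := bwd _ dN'.
have [finS S0 Sr] := sok p _ dN'.
apply: tame_cuts finS S0 Sr clarke cuts.
apply: bellman_tame vE => //.
by rewrite subnSK//; apply: ih; exact: ltnW.
Qed.

End Cost_to_go.

(** * Feasibility of the trial trajectory and the gap bound *)

Lemma forward_pass_feasible (R : realType) (m N : nat) (P : path_problem R m N)
    (D : rddp_data R m) p :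
  forward_pass P D p -> feasible P (traj D p) (ctrl D p).
Proof.
move=> [[[r0 init] _] fwd].
(* Controls are chosen so that the next state is again reachable. Reachability then supplies the
   state constraints, which [controls] does not mention, and at stage [N] the terminal condition. *)
have rk k : (k <= N)%N -> reach P k (traj D p k).
  elim: k => [//|k ih kN]; have [[[_ rn] _] ->] := fwd k kN.
  exact: rn.
split => //.
- move=> k kN; have [[[ok _] _] ->] := fwd k kN; split => //.
  exact: reach_state_ok kN (rk k (ltnW kN)).
- by have [xs [us [<- _]]] := rk N (leqnn N).
Qed.

Unset Implicit Arguments.

Theorem theorem1 (R : realType) (m N : nat) (hm : (2 <= m)%N) (hN : (1 <= N)%N)
    (P : path_problem R m N)
    (hDelta : forall k : nat, (k < N)%N -> 0 < Delta P k)
    (hreg : regular P) (hcopp : is_copp P) (hadm : admissible_controls P)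
    (D : rddp_data R m) (hD : rddp P D) (p : nat) :
  0 <= total_cost P (traj D p) (ctrl D p) - optimal_value P <= eps_gap P D p.
Proof.
have [sok /(_ p)[bwd fwd _]] := hD.
have [_ _ le_cost] := vapp_tame hreg hcopp hadm sok bwd (leq0n N).
have feas := forward_pass_feasible fwd.
(* Any feasible initial state competes in the minimization that defines the trial initial state, and
   its approximate value is at most the cost of its trajectory. *)
have lb : lbound
    [set J | exists xs us, feasible P xs us /\ J = total_cost P xs us]
    (vapp D p 0 (traj D p 0)).
  move=> _ [xs [us [[fxu xi xN] ->]]].
  have [[_ min0] _] := fwd.
  apply: (le_trans (min0 (xs 0%N) _)).
    by split => //; exact: follows_reach (leqnn 0) fxu xN.
  have := le_cost xs us fxu xN.
  by rewrite /cost_to_go big_mkord.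
(* After cancelling the trial cost, the optimal value has to lie between [vapp] at the trial initial
   state and the trial cost. Feasibility of the trial trajectory gives the upper bound, and also the
   nonemptiness required for the lower one. *)
rewrite subr_ge0 lerD2l lerN2; apply/andP; split.
  by apply: ge_inf;
    [exists (vapp D p 0 (traj D p 0))|exists (traj D p), (ctrl D p)].
apply: lb_le_inf lb.
by exists (total_cost P (traj D p) (ctrl D p)), (traj D p), (ctrl D p).
Qed.
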